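(* For each $n$ let $\mathbf{w}=(w_1,\ldots,w_n)\in\mathbb{R}_+^n$ be a collection of vertex weights satisfying $\max_{i\in[n]}w_i\le\sqrt{\sum_{i\in[n]}w_i}$ and let $s\in[0,1]$ (both possibly depending on $n$). Let $(G_1,G_2)$ be a pair of correlated Chung-Lu graphs with parameters $(\mathbf{w},s)$ and latent permutation $\pi_*$. Denote $w_{\max}:=\max_{i\in[n]}w_i$ and $w_{\min}:=\min_{i\in[n]}w_i$. Suppose that $w_{\max}$ is bounded as $n\to\infty$ and that there is a constant $\epsilon>0$ such that $$w_{\min}s^2\ge\max\Bigl\{\Bigl(\frac{w_{\max}}{w_{\min}}\Bigr)^2,154\Bigr\}+\epsilon .$$ Let $k=13$ and let $(\widehat M_k,\widehat\mu_k)$ be the $k$-core estimator of $(G_1,G_2)$. Then with probability $1-o(1)$ as $n\to\infty$ it holds that $$|\widehat M_k|\ge\Bigl(1-3e^{-\min_{i\in[n]}\sum_{j=1}^n p_{ij}s^2/7}\Bigr)n-o(n)\quad\text{and}\quad\widehat\mu_k\{\widehat M_k\}=\pi_*\{\widehat M_k\},$$ where $p_{ij}=w_iw_j/(\sum_{l\in[n]}w_l)$ for distinct $i,j$, and $p_{ii}=0$.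
   Context: Correlated Chung-Lu graphs with parameters $(\mathbf{w},s)$: generate a simple undirected random graph $G$ on $[n]$ in which each edge $\{i,j\}$, $i\ne j$, is present with probability $p_{ij}=w_iw_j/(\sum_{l\in[n]}w_l)$, independently over unordered pairs; conditionally on $G$, generate $G_1$ and $G_2'$ independently, each keeping every edge of $G$ independently with probability $s$ (same vertex set $[n]$); finally let $\pi_*$ be an independent uniformly random permutation of $[n]$ and let $G_2$ be $G_2'$ with vertices relabelled by $\pi_*$, so that $\{\pi_*(i),\pi_*(j)\}$ is an edge of $G_2$ iff $\{i,j\}$ is an edge of $G_2'$. A matching is a pair $(M,\mu)$ with $M\subseteq[n]$ and $\mu:M\to[n]$ injective. $G_1\wedge_\mu G_2$ is the graph on vertex set $M$ in which $\{i,j\}$ is an edge iff $\{i,j\}$ is an edge of $G_1$ and $\{\mu(i),\mu(j)\}$ is an edge of $G_2$. A matching is a $k$-core matching if every vertex of $G_1\wedge_\mu G_2$ has degree at least $k$ (the empty matching qualifies vacuously). The $k$-core estimator $(\widehat M_k,\widehat\mu_k)$ is a $k$-core matching of $(G_1,G_2)$ with $|M|$ as large as possible among all $k$-core matchings (ties broken arbitrarily). For a map $\mu$ and a subset $S$ of its domain, $\mu\{S\}:=\{(i,\mu(i)):i\in S\}$. The $o(n)$ term denotes a deterministic sequence $a_n$ with $a_n/n\to0$. *)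

(* Defs.v *)
From HB Require Import structures.
From mathcomp Require Import all_boot all_order all_algebra all_fingroup.
From mathcomp Require Import all_classical all_reals all_analysis.
Import Order.TTheory GRing.Theory Num.Theory.
Import numFieldNormedType.Exports.

Set Implicit Arguments.
Unset Strict Implicit.
Unset Printing Implicit Defensive.

Local Open Scope ring_scope.

Section Extrema.
Variables (R : realType) (n : nat).

(* The seed is the first value of f, so for n > 0 these are the genuine
   maximum and minimum whatever the signs (both are 0 for n = 0). *)
Definition fmax (f : 'I_n -> R) : R :=
  \big[Num.max/head 0 (codom f)]_(i < n) f i.

Definition fmin (f : 'I_n -> R) : R :=
  \big[Num.min/head 0 (codom f)]_(i < n) f i.

Lemma head_codom_ord (f : 'I_n -> R) :
  (0 < n)%N -> exists i, head 0 (codom f) = f i.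
Proof.
move=> n0; have : head 0 (codom f) \in codom f.
  have: size (codom f) = n by rewrite size_codom card_ord.
  by case: (codom f) => [n0'|x l _]; [rewrite -n0' in n0 | exact: mem_head].
by move=> /codomP.
Qed.

Lemma fmaxP (f : 'I_n -> R) : (0 < n)%N ->
  (exists i, fmax f = f i) /\ (forall i, f i <= fmax f).
Proof.
move=> n0; split; last by move=> i; exact: le_bigmax.
rewrite /fmax; elim/big_ind: _ => [|x y [i ->] [j ->]|i _]; last by exists i.
- exact: head_codom_ord.
- by case: (leP (f i) (f j)) => _; [exists j|exists i].
Qed.

Lemma fminP (f : 'I_n -> R) : (0 < n)%N ->
  (exists i, fmin f = f i) /\ (forall i, fmin f <= f i).
Proof.
move=> n0; split; last by move=> i; exact: bigmin_le.
rewrite /fmin; elim/big_ind: _ => [|x y [i ->] [j ->]|i _]; last by exists i.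
- exact: head_codom_ord.
- by case: (leP (f i) (f j)) => _; [exists i|exists j].
Qed.

End Extrema.

Section Graphs.
Variable n : nat.

(* An unordered pair of distinct vertices, encoded with increasing entries;
   a simple graph on 'I_n is an arbitrary set of such pairs. *)
Definition edge := {x : 'I_n * 'I_n | (x.1 < x.2)%N}.

Definition graph := {set edge}.

Definition adj (G : graph) (i j : 'I_n) : bool :=
  [exists e in G, (val e == (i, j)) || (val e == (j, i))].

Definition relabel (pi : 'S_n) (G : graph) : graph :=
  [set e : edge | adj G ((pi^-1)%g (val e).1) ((pi^-1)%g (val e).2)].

Lemma adj_sym G i j : adj G i j = adj G j i.
Proof. by apply: eq_existsb => e; rewrite orbC. Qed.

Lemma adj_irrefl G i : adj G i i = false.
Proof.
apply/existsP => -[e /andP[_]]; rewrite orbb => /eqP ei.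
by have := valP e; rewrite ei /= ltnn.
Qed.

Lemma adj_edge G (e : edge) : adj G (val e).1 (val e).2 = (e \in G).
Proof.
apply/existsP/idP => [[e' /andP[e'G]]|eG]; last first.
  by exists e; rewrite eG -surjective_pairing eqxx.
rewrite -surjective_pairing => /orP[/eqP/val_inj <-//|/eqP e'e].
by have := valP e'; rewrite e'e /= ltnNge ltnW ?(valP e).
Qed.

Lemma adj_relabel (pi : 'S_n) G i j :
  adj (relabel pi G) (pi i) (pi j) = adj G i j.
Proof.
wlog lt_ij: i j / (pi i < pi j)%N => [hw|].
  case: (ltngtP (pi i) (pi j)) => [/hw//|/hw|/val_inj/perm_inj ->].
    by rewrite ![adj _ _ j]adj_sym adj_sym => ->; rewrite adj_sym.
  by rewrite !adj_irrefl.
by rewrite (adj_edge _ (exist _ (pi i, pi j) lt_ij)) inE /= !permK.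
Qed.

End Graphs.

Section ChungLu.
Variables (R : realType) (n : nat).

Definition cl_p (w : 'I_n -> R) (i j : 'I_n) : R :=
  if i == j then 0 else w i * w j / \sum_(l < n) w l.

Definition cl_mass (w : 'I_n -> R) (G : graph n) : R :=
  \prod_(e : edge n)
    (if e \in G then cl_p w (val e).1 (val e).2
     else 1 - cl_p w (val e).1 (val e).2).

(* Conditional probability of obtaining H when every edge of G is kept
   independently with probability s. *)
Definition subsample_mass (s : R) (G H : graph n) : R :=
  if H \subset G then \prod_(e in G) (if e \in H then s else 1 - s) else 0.

(* (G, G_1, G_2', pi) *)
Definition outcome := (graph n * graph n * graph n * 'S_n)%type.

Definition parent_graph (o : outcome) : graph n := o.1.1.1.
Definition first_graph (o : outcome) : graph n := o.1.1.2.
Definition unshuffled_second_graph (o : outcome) : graph n := o.1.2.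
Definition latent_perm (o : outcome) : 'S_n := o.2.
Definition second_graph (o : outcome) : graph n :=
  relabel (latent_perm o) (unshuffled_second_graph o).

Definition corr_cl_mass (w : 'I_n -> R) (s : R) (o : outcome) : R :=
  cl_mass w (parent_graph o)
  * subsample_mass s (parent_graph o) (first_graph o)
  * subsample_mass s (parent_graph o) (unshuffled_second_graph o)
  * (n`!%:R)^-1.

Definition corr_cl_prob (w : 'I_n -> R) (s : R) (A : pred outcome) : R :=
  \sum_(o | A o) corr_cl_mass w s o.

Lemma cl_mass_sum1 w : \sum_(G : graph n) cl_mass w G = 1.
Proof.
rewrite /cl_mass -bigA_distr big1 // => e _.
by rewrite /= addrC subrK.
Qed.

Lemma subsample_mass_sum1 s G : \sum_(H : graph n) subsample_mass s G H = 1.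
Proof.
transitivity (\prod_(e : edge n)
  ((if e \in G then s else 0) + (if e \in G then 1 - s else 1))).
  rewrite bigA_distr; apply: eq_bigr => H _; rewrite /subsample_mass.
  case: ifPn => [/fintype.subsetP HG|/subsetPn[e eH eG]].
    rewrite big_mkcond /=; apply: eq_bigr => e _.
    by case: (boolP (e \in H)) => [/HG ->|] //; case: ifP.
  by rewrite (bigD1 e) //= eH (negbTE eG) mul0r.
rewrite big1 // => e _; case: ifP => _; last by rewrite /= add0r.
by rewrite /= addrC subrK.
Qed.

Lemma corr_cl_prob_total w s : corr_cl_prob w s predT = 1.
Proof.
have fact_neq0 : (n`!%:R : R) != 0 by rewrite pnatr_eq0 -lt0n fact_gt0.
rewrite /corr_cl_prob.
transitivity (\sum_(x : graph n * graph n * graph n) cl_mass w x.1.1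
    * subsample_mass s x.1.1 x.1.2 * subsample_mass s x.1.1 x.2).
  rewrite -(pair_bigA _ (fun x y => corr_cl_mass w s (x, y))) /=.
  apply: eq_bigr => x _; rewrite /corr_cl_mass /parent_graph /first_graph.
  rewrite /unshuffled_second_graph /=.
  rewrite -mulr_sumr.
  have -> : \sum_(i : 'S_n) (n`!%:R : R)^-1 = 1.
    by rewrite sumr_const card_Sn -[LHS]mulr_natr mulVf.
  by rewrite mulr1.
rewrite -(pair_bigA _ (fun x y => cl_mass w x.1 * subsample_mass s x.1 x.2
   * subsample_mass s x.1 y)) /=.
under eq_bigr do rewrite -mulr_sumr subsample_mass_sum1 mulr1.
rewrite -(pair_bigA _ (fun x y => cl_mass w x * subsample_mass s x y)) /=.
under eq_bigr do rewrite -mulr_sumr subsample_mass_sum1 mulr1.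
exact: cl_mass_sum1.
Qed.

End ChungLu.

Section Matchings.
Variable n : nat.

(* The pair (M, mu) with mu given by a total function of which only the
   restriction to M matters. *)
Definition matching := ({set 'I_n} * {ffun 'I_n -> 'I_n})%type.

Definition is_matching (m : matching) : Prop := {in m.1 &, injective m.2}.

Definition intersection_adj (G1 G2 : graph n) (m : matching) : rel 'I_n :=
  [rel i j | [&& i \in m.1, j \in m.1, adj G1 i j & adj G2 (m.2 i) (m.2 j)]].

Definition intersection_degree (G1 G2 : graph n) (m : matching) (i : 'I_n) :=
  #|[set j | intersection_adj G1 G2 m i j]|.

Definition is_core_matching (k : nat) (G1 G2 : graph n) (m : matching) : Prop :=
  is_matching m /\
  forall i, i \in m.1 -> (k <= intersection_degree G1 G2 m i)%N.

Definition is_core_estimate (k : nat) (G1 G2 : graph n) (m : matching) : Prop :=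
  is_core_matching k G1 G2 m /\
  forall m', is_core_matching k G1 G2 m' -> (#|m'.1| <= #|m.1|)%N.

(* mu{S} = {(i, mu(i)) : i in S} *)
Definition map_graph (f : 'I_n -> 'I_n) (S : {set 'I_n}) :
  {set 'I_n * 'I_n} := [set (i, f i) | i in S].

End Matchings.

Section Estimator.
Variables (n k : nat).

(* The estimate may depend on the whole outcome, not only on (G_1, G_2):
   ties between maximum k-core matchings are broken in a completely arbitrary
   way, as long as the result is a maximum one for the observed pair. *)
Definition is_core_estimator (est : outcome n -> matching n) : Prop :=
  forall o, is_core_estimate k (first_graph o) (second_graph o) (est o).

End Estimator.

(* Main.v *)
Require Import Defs.
From mathcomp Require Import all_boot all_order all_algebra all_fingroup.
From mathcomp Require Import all_classical all_reals all_analysis.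
From mathcomp Require Import ring lra zify.
Import Order.TTheory GRing.Theory Num.Theory.
Import numFieldNormedType.Exports.

Set Implicit Arguments.
Unset Strict Implicit.
Unset Printing Implicit Defensive.

(** Relabelling the second graph by the inverse of the latent permutation
    reduces everything to the pair of unshuffled graphs: the true matching is
    then the identity, and the intersection [H] of the two graphs is a random
    graph with independent edges, of probabilities [p_ij * s ^+ 2].  Only
    two events can spoil the estimate, and first moments bound the probability
    of each by [O(1/n)]; the theorem holds with a zero error term.

    No 13-core matching has an error.  Let [nu] move exactly the [d > 0]
    vertices of a set [A].  Each moved vertex has degree at least 13 in the
    intersection along [nu].  An edge that [nu] maps to itself while moving
    its ends joins [i] to [nu i], so it accounts for at most one unit of the
    degree of [i]; the other edges, weighted by the number of their endpoints
    in [A], weigh at least [12 * d].  Each of these edges conflicts only with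
    its image and its preimage under [nu], so a greedy choice retains a third
    of the weight, hence [4 * d], in a set [T] that is disjoint from its image
    ([core_matching_error]).  As [T] and its image are disjoint sets of edges
    of probability at most [c / n], that [T] lies in the first graph and its
    image in the second has probability at most [(c / n) ^+ (2 * #|T|)]
    ([cl_expectation_edges_subset]).  There are at most [d ^ 2] edges of
    weight two and [2 * n * d] of weight one, and an exponential tilt of the
    weight bounds the sum over [T] by
    [(d ^+ 2 / n ^+ 4 * expR (3 * c ^+ 2)) ^+ d]; this beats the number
    ['C(n, d) * n ^ d] of maps [nu], and the sum over [d] is of order [1 / n]
    ([sum_all_errors_le]).

    The graph [H] has a large 13-core.  If its 13-core missed at least [m]
    vertices, removing vertices of degree at most 12 one by one would produce a
    set of exactly [m] vertices with at most [12 * m] edges of [H] on its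
    boundary ([core_exists]).  Let [delta] be a seventh of the minimal mean
    degree of [H] and [m] about [3 * expR (- delta) * n].  The bound on
    [w_max / w_min] makes the total weight of any [m] vertices a small fraction
    of the whole, so that the boundary has mean at least
    [3 / 5 * m * w_min * s ^+ 2] ([sum_cut_ge]).  A Chernoff bound for it
    beats the ['C(n, m)] choices of the set, because the latter number is at
    most [expR (m * (delta + 1))] ([prob_sparse_cut_event_le],
    [entropy_beaten]).  The 13-core of [H] with the latent permutation is a
    13-core matching, so a largest one has more than [n - m] vertices. *)

(** * Matchings with errors *)

(** Greedy choice: take a heaviest [e] and discard the points in conflict with
    it, namely [g e] and the preimage of [e].  At most three points, none
    heavier than [e], leave [F] at each step. *)
Lemma heavy_independent_subset (T : finType) (g : T -> T) (h : T -> nat)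
    (F : {set T}) :
  {in F &, injective g} -> {in F, forall x, g x != x} ->
  exists T' : {set T}, [/\ T' \subset F, [disjoint T' & g @: T'] &
    \sum_(x in F) h x <= 3 * \sum_(x in T') h x].
Proof.
have [m] := ubnP #|F|; elim: m F => // m IH F; rewrite ltnS => Fm injg fixg.
have [->|[x0 x0F]] := finset.set_0Vmem F.
  exists finset.set0; rewrite finset.sub0set big_set0; split=> //.
  by rewrite -finset.setI_eq0 finset.set0I.
pose e := [arg max_(x > x0 in F) h x].
have [eF emax] : e \in F /\ forall x, x \in F -> h x <= h e.
  by rewrite /e; case: arg_maxnP => //.
pose K := [set x | [|| x == e, x == g e | g x == e]].
have KF : F :\: K \proper F.
  apply/fintype.properP; split; first exact: finset.subsetDl.
  by exists e => //; rewrite !inE eqxx.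
have [||| T2 [T2F T2dis T2h]] := IH (F :\: K).
- exact: leq_trans (proper_card KF) Fm.
- by move=> x y; rewrite !inE => /andP[_ xF] /andP[_ yF]; exact: injg.
- by move=> x; rewrite inE => /andP[_ xF]; exact: fixg.
have eT2 : e \notin T2.
  by apply: contraTN isT => /(fintype.subsetP T2F); rewrite !inE eqxx.
exists (e |: T2); split.
- rewrite finset.subUset finset.sub1set eF; apply: fintype.subset_trans T2F _.
  exact: finset.subsetDl.
- rewrite -finset.setI_eq0; apply/eqP/finset.setP => x; rewrite finset.in_setI finset.in_set0.
  apply/negP => /andP[xT /imsetP[y yT xgy]]; move: xT yT.
  rewrite !finset.in_setU1 => /orP[/eqP xe|xT] /orP[/eqP ye|yT].
  + by move: (fixg e eF); rewrite -{1}ye -xgy xe eqxx.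
  + by have := fintype.subsetP T2F y yT; rewrite !inE -xgy xe eqxx !orbT.
  + by have := fintype.subsetP T2F x xT; rewrite !inE xgy ye eqxx !orbT.
  + by move: T2dis => /disjointFr/(_ xT); rewrite xgy imset_f.
rewrite big_setU1 //= (big_setID K) /= mulnDr leq_add //.
have cardK : #|F :&: K| <= 3.
  have pre1 : #|[set x in F | g x == e]| <= 1.
    apply/card_le1_eqP => x y; rewrite !inE => /andP[xF /eqP gx] /andP[yF /eqP gy].
    by apply: injg => //; rewrite gx gy.
  apply: (@leq_trans (#|[set e; g e]| + #|[set x in F | g x == e]|)).
    apply: leq_trans (finset.leq_card_setU _ _); apply: subset_leq_card.
    apply/fintype.subsetP => x; rewrite !inE => /andP[-> /or3P[]->//]; by rewrite ?orbT.
  by rewrite cards2; case: (_ != _) => /=; lia.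
apply: (@leq_trans (\sum_(x in F :&: K) h e)).
  by apply: leq_sum => x; rewrite inE => /andP[xF _]; exact: emax.
by rewrite sum_nat_const leq_mul2r cardK orbT.
Qed.

Section Lift.
Variable n : nat.
Implicit Types (A : {set 'I_n}) (G F : graph n) (e : edge n).

(** The map induced on edges; the default value of [insubd] is used only when
    [nu] identifies the two endpoints. *)
Definition lift_edge (nu : 'I_n -> 'I_n) e : edge n :=
  let i := nu (val e).1 in let j := nu (val e).2 in
  insubd e (if (i < j)%N then (i, j) else (j, i)).

Definition endpoints_in A e : nat := ((val e).1 \in A) + ((val e).2 \in A).

Definition moved (nu : 'I_n -> 'I_n) : {set 'I_n} := [set i | nu i != i].

Lemma val_lift_edge nu e : nu (val e).1 != nu (val e).2 ->
  val (lift_edge nu e) = (nu (val e).1, nu (val e).2)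
  \/ val (lift_edge nu e) = (nu (val e).2, nu (val e).1).
Proof.
move=> nue; rewrite /lift_edge val_insubd.
have [h|h] := ltnP (nu (val e).1) (nu (val e).2); first by rewrite /= h; left.
rewrite /= ltn_neqAle h andbT (inj_eq val_inj) eq_sym nue.
by right.
Qed.

Lemma adj_lift_edge G nu e : nu (val e).1 != nu (val e).2 ->
  adj G (nu (val e).1) (nu (val e).2) = (lift_edge nu e \in G).
Proof.
move=> /val_lift_edge[] h; rewrite -adj_edge h //=.
exact: adj_sym.
Qed.

(** Double counting of the pairs of a vertex of [A] and an edge at it. *)
Lemma sum_degree_le A F :
  \sum_(i in A) #|[set j | adj F i j]| <= \sum_(e in F) endpoints_in A e.
Proof.
have degE i : #|[set j | adj F i j]| <=
    \sum_(e in F) (((val e).1 == i) + ((val e).2 == i)).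
  rewrite -sum1_card big_mkcond /=.
  apply: (@leq_trans (\sum_j \sum_(e in F)
      ((val e == (i, j)) + (val e == (j, i))))).
    apply: leq_sum => j _; rewrite inE; case: ifP => // /existsP[e /andP[eF h]].
    rewrite (bigD1 e) //=; move: h; case: (val e == (i, j)) => //= ->.
    by rewrite add0n ltn_addr.
  rewrite exchange_big /=; apply: leq_sum => e _.
  rewrite big_split /= leq_add //.
    rewrite (bigD1 (val e).2) //= big1 ?addn0 => [|j jne].
      by case: (val e) => a b /=; rewrite xpair_eqE eqxx andbT.
    move: jne; case: (val e) => a b /= jb.
    by rewrite xpair_eqE [b == j]eq_sym (negbTE jb) andbF.
  rewrite (bigD1 (val e).1) //= big1 ?addn0 => [|j jne].
    by case: (val e) => a b /=; rewrite xpair_eqE eqxx.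
  move: jne; case: (val e) => a b /= jb.
  by rewrite xpair_eqE [a == j]eq_sym (negbTE jb).
apply: leq_trans (leq_sum _ (fun i _ => degE i)) _.
rewrite exchange_big /=; apply: leq_sum => e _; rewrite big_split /=.
have inE' (x : 'I_n) : \sum_(i in A) (x == i) = (x \in A).
  case: (boolP (x \in A)) => xA.
    rewrite (bigD1 x) //= eqxx big1 // => i /andP[_ ix].
    by rewrite eq_sym (negbTE ix).
  by rewrite big1 // => i iA; case: eqP => // xi; rewrite xi iA in xA.
by rewrite !inE'.
Qed.

(** The evidence that a core matching with errors leaves behind.  It refers to
    [nu] only, so that union bounds run over [nu] and [T] alone, and the
    disjointness and injectivity clauses make the presence of [T] in one graph
    and of its image in the other cost two independent edges for each element
    of [T]. *)
Definition error_witness (nu : 'I_n -> 'I_n) (T : {set edge n}) : bool :=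
  [&& [disjoint T & lift_edge nu @: T], #|lift_edge nu @: T| == #|T|,
      [forall e in T, 0 < endpoints_in (moved nu) e]
    & 4 * #|moved nu| <= \sum_(e in T) endpoints_in (moved nu) e].

Definition error_event (o : outcome n) : bool :=
  [exists nu : {ffun 'I_n -> 'I_n}, (moved nu != finset.set0) &&
    [exists T : {set edge n}, error_witness nu T &&
      ((T \subset first_graph o)
       && (lift_edge nu @: T \subset unshuffled_second_graph o))]].

(** The factor [4] in [error_witness] is [(13 - 1) / 3]: one unit of the degree
    of [i] may come from the edge between [i] and its image, and a third of the
    weight survives the choice of an independent subset. *)
Lemma core_matching_error (G1 G2 : graph n) (m : matching n) (i0 : 'I_n) :
  is_core_matching 13 G1 G2 m -> i0 \in m.1 -> m.2 i0 != i0 ->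
  exists nu : {ffun 'I_n -> 'I_n}, moved nu != finset.set0 /\
    exists2 T : {set edge n}, error_witness nu T &
      (T \subset G1) && (lift_edge nu @: T \subset G2).
Proof.
case: m => M nu0 [/= injnu0 core] i0M nui0.
(* Forgetting the matching outside its domain leaves exactly its errors moved. *)
pose nu : {ffun 'I_n -> 'I_n} := [ffun i => if i \in M then nu0 i else i].
have nuM i : i \in M -> nu i = nu0 i by rewrite ffunE => ->.
have injnu : {in M &, injective nu}.
  by move=> i j iM jM; rewrite !nuM //; exact: injnu0.
have movedM i : i \in moved nu -> i \in M.
  by rewrite inE ffunE; case: ifP => //; rewrite eqxx.
exists nu; split; first by apply/finset.set0Pn; exists i0; rewrite inE nuM.
pose g := lift_edge nu.
pose F := [set e : edge n | [&& (val e).1 \in M, (val e).2 \in M, e \in G1,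
   adj G2 (nu (val e).1) (nu (val e).2) & g e != e]].
have edge_neq e : (val e).1 != (val e).2.
  by apply/eqP => h; have := valP e; rewrite /= h ltnn.
have nu_neq e : e \in F -> nu (val e).1 != nu (val e).2.
  rewrite inE => /andP[e1 /andP[e2 _]].
  by apply: contra_neq (edge_neq e); exact: injnu.
have ginj : {in F &, injective g}.
  move=> e e' eF e'F gee'; have := val_lift_edge (nu_neq e eF).
  have := val_lift_edge (nu_neq e' e'F).
  move: eF e'F; rewrite !inE => /andP[e1 /andP[e2 _]] /andP[e1' /andP[e2' _]].
  rewrite -/g gee' => ge'; have [//|/eqP ee'] := eqVneq e e'.
  have swap : val e <> ((val e').2, (val e').1).
    move=> h; have := valP e; rewrite h /= => lt'; have := valP e' => /=.
    by rewrite ltnNge ltnW.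
  case: ge' => ->; case=> -[/injnu h1 /injnu h2].
  - case: ee'; apply: val_inj; rewrite [LHS]surjective_pairing.
    by rewrite -h1 // -h2 // -surjective_pairing.
  - by case: swap; rewrite [LHS]surjective_pairing -(h2 e2' e1) -(h1 e1' e2).
  - by case: swap; rewrite [LHS]surjective_pairing -(h1 e2' e1) -(h2 e1' e2).
  - case: ee'; apply: val_inj; rewrite [LHS]surjective_pairing.
    by rewrite -h1 // -h2 // -surjective_pairing.
have [||T [TF Tdis Th]] := @heavy_independent_subset _ g (endpoints_in (moved nu)) F.
- exact: ginj.
- by move=> e; rewrite inE => /and5P[].
pose T' := [set e in T | 0 < endpoints_in (moved nu) e].
have T'T : T' \subset T by apply/fintype.subsetP => e; rewrite inE => /andP[].
(* An edge at a moved vertex [i] that is mapped to itself ends at [nu i]. *)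
have deg12 i : i \in moved nu -> 12 <= #|[set j | adj F i j]|.
  move=> im; have iM := movedM i im.
  rewrite -ltnS; apply: leq_trans (core i iM) _.
  apply: (@leq_trans #|nu i |: [set j | adj F i j]|); last first.
    by rewrite cardsU1 -add1n leq_add2r leq_b1.
  apply: subset_leq_card; apply/fintype.subsetP => j.
  rewrite !inE /= => /and4P[_ jM a1]; rewrite -!nuM // => a2.
  case: eqP => //= jnui; move: a1 => /existsP[e /andP[eG1 eij]].
  apply/existsP; exists e; rewrite eij andbT inE eG1 /=.
  have nuij : nu i != nu j.
    by apply: contraTneq a2 => ->; rewrite adj_irrefl.
  move: im; rewrite inE => /eqP im.
  case/orP: eij => /eqP eij; rewrite eij /= jM iM /=.
    rewrite a2 /=; apply/eqP => /(congr1 val).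
    have := @val_lift_edge nu e; rewrite eij /= => /(_ nuij) [] -> [] //.
    by move=> _ /esym.
  rewrite adj_sym a2 /=; apply/eqP => /(congr1 val).
  have := @val_lift_edge nu e; rewrite eij /= eq_sym => /(_ nuij) [] -> [] //.
  by move=> /esym.
exists T'; last first.
  apply/andP; split; apply/fintype.subsetP => e.
    by rewrite inE => /andP[/(fintype.subsetP TF)]; rewrite inE => /and5P[].
  move=> /imsetP[e' e'T ->]; have e'F := fintype.subsetP TF _ (fintype.subsetP T'T _ e'T).
  by rewrite -adj_lift_edge ?nu_neq //; move: e'F; rewrite inE => /and5P[].
apply/and4P; split.
- rewrite -finset.setI_eq0 -finset.subset0.
  move: Tdis; rewrite -finset.setI_eq0 -finset.subset0.
  by apply: fintype.subset_trans; apply: finset.setISS => //; exact: finset.imsetS.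
- apply/eqP/card_in_imset => e e' eT eT'; apply: ginj; apply: (fintype.subsetP TF);
    exact: (fintype.subsetP T'T).
- by apply/forall_inP => e; rewrite inE => /andP[].
rewrite -(leq_pmul2l (isT : 0 < 3)) mulnA.
have -> : \sum_(e in T') endpoints_in (moved nu) e =
          \sum_(e in T) endpoints_in (moved nu) e.
  rewrite [RHS](bigID (fun e => 0 < endpoints_in (moved nu) e)) /=.
  rewrite [X in _ = _ + X]big1 ?addn0 => [|e /andP[_]]; last first.
    by rewrite lt0n negbK => /eqP.
  by apply: eq_bigl => e; rewrite inE.
apply: leq_trans Th; apply: leq_trans (sum_degree_le _ _).
by rewrite mulnC -sum_nat_const; exact: leq_sum.
Qed.

End Lift.

Local Open Scope ring_scope.

(** * Large cores *)

Section Core.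
Variable n : nat.
Implicit Types (S : {set 'I_n}) (H : graph n) (e : edge n).

Definition crosses S e : bool := ((val e).1 \in S) != ((val e).2 \in S).

(** The edges that start crossing when [i] joins [S] are those between [i] and
    a neighbour outside [S]. *)
Lemma card_crosses_setU1 H S (i : 'I_n) : i \notin S ->
  (#|[set e in H | crosses (i |: S) e]| <=
   #|[set e in H | crosses S e]| + #|[set j | (j \notin S) && adj H i j]|)%N.
Proof.
move=> iS; rewrite -(cardsID [set e | crosses S e]) leq_add //.
  apply: subset_leq_card; apply/fintype.subsetP => e.
  by rewrite !inE => /andP[/andP[-> _] ->].
set E := _ :\: _.
pose f e := if (val e).1 == i then (val e).2 else (val e).1.
have EP e : e \in E -> [/\ e \in H, (val e).1 = i \/ (val e).2 = i,
    (val e).1 \notin S & (val e).2 \notin S].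
  rewrite !inE /crosses !inE => /and3P[h1 h2 h3]; move: h1 h3.
  have [->|] := eqVneq (val e).1 i; have [->|] := eqVneq (val e).2 i;
    rewrite ?eqxx ?(negbTE iS) //=.
  - by move=> _; case: (_ \in S) => // _ _; split=> //; left.
  - by move=> _; case: (_ \in S) => // _ _; split=> //; right.
  - by move=> _ _; case: (_ \in S); case: (_ \in S).
have f_inj : {in E &, injective f}.
  move=> e e' /EP[_ e12 _ _] /EP[_ e12' _ _]; rewrite /f.
  have := valP e; have := valP e'.
  case: eqVneq => [h1|h1]; case: eqVneq => [h2|h2] /= lt' lt h3; apply: val_inj => /=.
  - by rewrite [LHS]surjective_pairing [RHS]surjective_pairing h1 h2 h3.
  - case: e12' => [h|h]; first by rewrite h eqxx in h2.
    by move: lt lt'; rewrite h h1 h3 => /ltnW; rewrite leqNgt => /negP.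
  - case: e12 => [h|h]; first by rewrite h eqxx in h1.
    by move: lt lt'; rewrite h h2 h3 => /ltnW; rewrite leqNgt => /negP.
  - case: e12 => [h|h]; first by rewrite h eqxx in h1.
    case: e12' => [h'|h']; first by rewrite h' eqxx in h2.
    by rewrite [LHS]surjective_pairing [RHS]surjective_pairing h h' h3.
rewrite -(card_in_imset f_inj); apply: subset_leq_card.
apply/fintype.subsetP => j /imsetP[e /EP[eH e12 e1 e2] ->]; rewrite inE /f.
case: eqVneq => [h|h].
  by rewrite e2 -h adj_edge.
by case: e12 => [h'|<-]; [rewrite h' eqxx in h|rewrite e1 adj_sym adj_edge].
Qed.

(** Growing a set one vertex at a time, always by a vertex with at most [k]
    neighbours outside, keeps at most [k] boundary edges per vertex.  The
    growth therefore stops before size [m], and what is then left outside is a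
    core of minimal degree more than [k]. *)
Lemma core_exists (k m : nat) H :
  (forall S, #|S| = m -> (k * m < #|[set e in H | crosses S e]|)%N) ->
  exists2 S : {set 'I_n}, (#|S| < m)%N &
    forall i, i \notin S -> (k < #|[set j | (j \notin S) && adj H i j]|)%N.
Proof.
move=> Hm.
pose P S := (#|S| <= m)%N && (#|[set e in H | crosses S e]| <= k * #|S|)%N.
have P0 : P finset.set0.
  rewrite /P cards0 leq0n muln0 leqn0 cards_eq0 /=; apply/eqP/setP => e.
  by rewrite !inE /crosses !inE eqxx andbF.
have [S /andP[Sm Scut] Smax] : exists2 S : {set 'I_n},
    P S & forall S', P S' -> (#|S'| <= #|S|)%N.
  exists [arg max_(S > finset.set0 | P S) #|S|]%N; first by case: arg_maxnP.
  by case: arg_maxnP.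
have ltSm : (#|S| < m)%N.
  rewrite ltn_neqAle Sm andbT; apply: contraTneq Scut => Sm'.
  by rewrite -ltnNge Sm' Hm.
exists S => // i iS; rewrite ltnNge; apply/negP => few.
have : P (i |: S).
  rewrite /P cardsU1 iS add1n ltSm /= mulnS addnC.
  exact: leq_trans (card_crosses_setU1 _ iS) (leq_add Scut few).
by move/Smax; rewrite cardsU1 iS add1n ltnn.
Qed.

Definition sparse_cut_event (m : nat) (o : outcome n) : bool :=
  [exists S : {set 'I_n}, (#|S| == m) &&
    (#|[set e in first_graph o :&: unshuffled_second_graph o | crosses S e]|
     <= 12 * m)%N].

(** An error in the estimate would be an error in a core matching, and the true
    core is one of the matchings that the estimate is at least as large as. *)
Lemma core_estimate_good (o : outcome n) (m : nat) (est : matching n) :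
  is_core_estimate 13 (first_graph o) (second_graph o) est ->
  ~~ error_event o -> ~~ sparse_cut_event m o ->
  (n < #|est.1| + m)%N /\
  map_graph est.2 est.1 = map_graph (latent_perm o) est.1.
Proof.
case: est => M mu [[/= injmu core] est_max] noerr nosparse; split; last first.
  apply: eq_in_imset => i iM; congr (_, _); apply/eqP.
  apply: contraNT noerr => neq.
  (* Undoing the latent permutation turns the matching into one of the
     unshuffled graphs, whose errors are the points that it moves. *)
  pose mu' : {ffun 'I_n -> 'I_n} := [ffun j => ((latent_perm o)^-1)%g (mu j)].
  have [||| nu [nu0 [T Tw TG]]] := @core_matching_error n (first_graph o)
      (unshuffled_second_graph o) (M, mu') i => //=.
  - split=> [j j' /= jM j'M|j jM].
      by rewrite !ffunE => /perm_inj; exact: injmu.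
    apply: leq_trans (core j jM) _; apply: subset_leq_card.
    apply/fintype.subsetP => j'; rewrite !inE /= => /and4P[h1 h2 h3 h4].
    apply/and4P; split=> //; move: h4.
    by rewrite !ffunE -[X in _ -> is_true X](adj_relabel (latent_perm o)) !permKV.
  - by rewrite ffunE (canF_eq (permKV _)).
  - apply/existsP; exists nu; rewrite nu0; apply/existsP; exists T.
    by rewrite Tw.
have [|S Sm Score] := @core_exists 12 m (first_graph o :&: unshuffled_second_graph o).
  move=> S Sm; rewrite ltnNge; apply: contraNN nosparse => h.
  by apply/existsP; exists S; rewrite Sm eqxx.
have : (#|~: S| <= #|M|)%N.
  apply: (est_max (~: S, [ffun i => latent_perm o i])); split.
    by move=> i j _ _; rewrite /= !ffunE; exact: perm_inj.
  move=> i /=; rewrite inE => iS; apply: leq_trans (Score i iS) _.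
  apply: subset_leq_card; apply/fintype.subsetP => j.
  rewrite /intersection_adj !inE /= !inE iS => /andP[-> /existsP[e /andP[]]].
  rewrite inE !ffunE adj_relabel => /andP[e1 e2] eij /=.
  by apply/andP; split; apply/existsP; exists e; rewrite eij andbT.
move=> le_CS; apply: (@leq_ltn_trans (#|S| + #|~: S|)).
  by rewrite cardsC card_ord.
by rewrite [ltnRHS]addnC -addSn leq_add.
Qed.

End Core.

(** * Expectations over the random graphs *)

Section Expectation.
Variables (R : realType) (n : nat) (w : 'I_n -> R) (s : R).

Definition edge_p (e : edge n) : R := cl_p w (val e).1 (val e).2.

(** The mean of [phi] at the states in the two subsampled graphs of an edge
    whose probability in the parent graph is [p]. *)
Definition edge_mean (p : R) (phi : bool -> bool -> R) : R :=
  p * (s * (s * phi true true + (1 - s) * phi true false)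
       + (1 - s) * (s * phi false true + (1 - s) * phi false false))
  + (1 - p) * phi false false.

Definition cl_expectation (f : outcome n -> R) : R :=
  \sum_o corr_cl_mass w s o * f o.

(** The constraint that a subsample is contained in its parent becomes a
    factor zero, so that every mass is a product over the edges. *)
Lemma subsample_mass_prod (G H : graph n) :
  subsample_mass s G H =
  \prod_e (if e \in H then (if e \in G then s else 0)
           else (if e \in G then 1 - s else 1)).
Proof.
rewrite /subsample_mass.
case: ifPn => [/fintype.subsetP HG|/subsetPn[e eH eG]].
  rewrite big_mkcond /=; apply: eq_bigr => e _.
  by case: (boolP (e \in H)) => [/HG ->|] //; case: ifP.
by rewrite (bigD1 e) //= eH (negbTE eG) mul0r.
Qed.

(** The states of distinct edges are independent: summing out the permutation
    and then, one after the other, the second, the first and the parent graph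
    distributes each sum over the product. *)
Lemma cl_expectation_prod (phi : edge n -> bool -> bool -> R) :
  cl_expectation (fun o => \prod_e phi e (e \in first_graph o)
                                   (e \in unshuffled_second_graph o))
  = \prod_e edge_mean (edge_p e) (phi e).
Proof.
have fact_neq0 : (n`!%:R : R) != 0 by rewrite pnatr_eq0 -lt0n fact_gt0.
rewrite /cl_expectation.
rewrite -(pair_bigA _ (fun x y => corr_cl_mass w s (x, y) *
  \prod_e phi e (e \in x.1.2) (e \in x.2))) /=.
transitivity (\sum_(x : graph n * graph n * graph n)
  \prod_e ((if e \in x.1.1 then edge_p e else 1 - edge_p e)
    * (if e \in x.1.2 then (if e \in x.1.1 then s else 0)
           else (if e \in x.1.1 then 1 - s else 1))
    * (if e \in x.2 then (if e \in x.1.1 then s else 0)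
           else (if e \in x.1.1 then 1 - s else 1))
    * phi e (e \in x.1.2) (e \in x.2))).
  apply: eq_bigr => x _; rewrite -mulr_suml /corr_cl_mass /parent_graph /first_graph
    /unshuffled_second_graph /=.
  rewrite sumr_const card_Sn -mulrnAr -[_^-1 *+ _]mulr_natr mulVf //.
  rewrite mulr1.
  by rewrite !subsample_mass_prod !big_split.
rewrite -(pair_bigA _ (fun (x : graph n * graph n) (y : graph n) =>
  \prod_e ((if e \in x.1 then edge_p e else 1 - edge_p e)
    * (if e \in x.2 then (if e \in x.1 then s else 0)
           else (if e \in x.1 then 1 - s else 1))
    * (if e \in y then (if e \in x.1 then s else 0)
           else (if e \in x.1 then 1 - s else 1))
    * phi e (e \in x.2) (e \in y)))) /=.
transitivity (\sum_(x : graph n * graph n)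
  \prod_e ((if e \in x.1 then edge_p e else 1 - edge_p e)
    * (if e \in x.2 then (if e \in x.1 then s else 0)
           else (if e \in x.1 then 1 - s else 1))
    * ((if e \in x.1 then s else 0) * phi e (e \in x.2) true
     + (if e \in x.1 then 1 - s else 1) * phi e (e \in x.2) false))).
  apply: eq_bigr => x _; under [RHS]eq_bigr do rewrite mulrDr.
  rewrite bigA_distr; apply: eq_bigr => H _; apply: eq_bigr => e _.
  by case: (e \in H); rewrite !mulrA.
rewrite -(pair_bigA _ (fun x y : graph n =>
  \prod_e ((if e \in x then edge_p e else 1 - edge_p e)
    * (if e \in y then (if e \in x then s else 0)
           else (if e \in x then 1 - s else 1))
    * ((if e \in x then s else 0) * phi e (e \in y) true
     + (if e \in x then 1 - s else 1) * phi e (e \in y) false)))) /=.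
transitivity (\sum_(x : graph n)
  \prod_e ((if e \in x then edge_p e else 1 - edge_p e)
    * ((if e \in x then s else 0) * ((if e \in x then s else 0) * phi e true true
     + (if e \in x then 1 - s else 1) * phi e true false)
    + (if e \in x then 1 - s else 1) * ((if e \in x then s else 0) * phi e false true
     + (if e \in x then 1 - s else 1) * phi e false false)))).
  apply: eq_bigr => x _; under [RHS]eq_bigr do rewrite mulrDr.
  rewrite bigA_distr; apply: eq_bigr => H _; apply: eq_bigr => e _.
  by case: (e \in H); rewrite !mulrA.
rewrite /edge_mean bigA_distr; apply: eq_bigr => H _; apply: eq_bigr => e _.
by case: (e \in H) => //; rewrite !mul0r !mul1r !add0r.
Qed.

Hypothesis s01 : 0 <= s <= 1.
Hypothesis p01 : forall i j, 0 <= cl_p w i j <= 1.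

Lemma corr_cl_mass_ge0 o : 0 <= corr_cl_mass w s o.
Proof.
have /andP[s0 s1] := s01.
have sub_ge0 (G H : graph n) : 0 <= subsample_mass s G H.
  rewrite subsample_mass_prod; apply: prodr_ge0 => e _.
  by case: ifP => _; case: ifP => _ //; rewrite subr_ge0.
rewrite /corr_cl_mass !mulr_ge0 ?invr_ge0 ?ler0n //.
apply: prodr_ge0 => e _; have /andP[p0 p1] := p01 (val e).1 (val e).2.
by case: ifP => _ //; rewrite subr_ge0.
Qed.

(** Markov's inequality at level one; a union bound is the case of a sum of
    indicators. *)
Lemma corr_cl_prob_le_cl_expectation (A : pred (outcome n)) (f : outcome n -> R) :
  (forall o, 0 <= f o) -> (forall o, A o -> 1 <= f o) ->
  corr_cl_prob w s A <= cl_expectation f.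
Proof.
move=> f0 f1; rewrite /corr_cl_prob /cl_expectation big_mkcond /=.
apply: ler_sum => o _; have m0 := corr_cl_mass_ge0 o.
case: ifPn => [/f1 h|_]; last exact: mulr_ge0.
by rewrite ler_peMr.
Qed.

Lemma corr_cl_prob_ge (A B1 B2 : pred (outcome n)) :
  (forall o, ~~ B1 o -> ~~ B2 o -> A o) ->
  1 - corr_cl_prob w s B1 - corr_cl_prob w s B2 <= corr_cl_prob w s A.
Proof.
move=> h; rewrite -(corr_cl_prob_total w s) /corr_cl_prob !lerBlDr.
rewrite [X in _ <= X + _ + _]big_mkcond [X in _ <= _ + X + _]big_mkcond.
rewrite [X in _ <= _ + X]big_mkcond -!big_split /=.
apply: ler_sum => o _; have m0 := corr_cl_mass_ge0 o.
have := h o; case: (B1 o); case: (B2 o); case: (A o) => //= h'; lra.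
Qed.

Lemma corr_cl_prob_le1 (A : pred (outcome n)) : corr_cl_prob w s A <= 1.
Proof.
rewrite -(corr_cl_prob_total w s) /corr_cl_prob big_mkcond /=.
by apply: ler_sum => o _; case: ifP => _ //; exact: corr_cl_mass_ge0.
Qed.

Lemma cl_expectation_sum (I : Type) (r : seq I) (P : pred I) (f : I -> outcome n -> R) :
  cl_expectation (fun o => \sum_(i <- r | P i) f i o) =
  \sum_(i <- r | P i) cl_expectation (f i).
Proof.
by rewrite /cl_expectation exchange_big; apply: eq_bigr => o _; rewrite mulr_sumr.
Qed.

Lemma cl_expectationZ (a : R) f :
  cl_expectation (fun o => a * f o) = a * cl_expectation f.
Proof. by rewrite mulr_sumr; apply: eq_bigr => o _; rewrite mulrCA. Qed.

(** Disjointness matters: an edge in both sets would contribute a single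
    factor [q], since the two subsamples are strongly correlated. *)
Lemma cl_expectation_edges_subset (q : R) (S1 S2 : graph n) :
  (forall e, edge_p e <= q) -> [disjoint S1 & S2] ->
  cl_expectation (fun o => ((S1 \subset first_graph o)
                 && (S2 \subset unshuffled_second_graph o))%:R)
  <= q ^+ (#|S1| + #|S2|).
Proof.
move=> pq S12; have /andP[s0 s1] := s01.
pose phi e (x y : bool) : R := ((e \in S1) ==> x)%:R * ((e \in S2) ==> y)%:R.
have subE (S G : graph n) : (S \subset G)%:R = \prod_e ((e \in S) ==> (e \in G))%:R :> R.
  case: (boolP (S \subset G)) => [/fintype.subsetP SG|/subsetPn[e eS eG]].
    by rewrite big1 // => e _; case: (boolP (e \in S)) => // /SG ->.
  by rewrite (bigD1 e) //= eS (negbTE eG) mul0r.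
have -> : cl_expectation (fun o => ((S1 \subset first_graph o)
                 && (S2 \subset unshuffled_second_graph o))%:R)
   = cl_expectation (fun o => \prod_e phi e (e \in first_graph o)
                                   (e \in unshuffled_second_graph o)).
  rewrite /cl_expectation; apply: eq_bigr => o _; congr (_ * _).
  by rewrite -mulnb natrM !subE -big_split.
rewrite cl_expectation_prod.
have -> : q ^+ (#|S1| + #|S2|) = \prod_e (if e \in S1 :|: S2 then q else 1).
  rewrite -big_mkcond /= prodr_const cardsU.
  by move: S12; rewrite -setI_eq0 => /eqP ->; rewrite cards0 subn0.
apply: ler_prod => e _; have /andP[p0 p1] := p01 (val e).1 (val e).2.
have := pq e; rewrite -/(edge_p e) in p0 p1 *.
rewrite /edge_mean /phi finset.in_setU => pqe.
have ps0 : 0 <= edge_p e * s by rewrite mulr_ge0.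
have ps1 : edge_p e * s <= edge_p e by rewrite ler_piMr.
have := disjointFr S12 (x := e).
case: (e \in S1); case: (e \in S2) => //= h; last by apply/andP; split; lra.
- by have := h isT.
- by apply/andP; split; lra.
- by apply/andP; split; lra.
Qed.

End Expectation.

(** * Matchings with errors are unlikely *)

Section Counting.
Variable R : realType.

(** One term of the exponential series at [d]. *)
Lemma exprn_le_fact_expR (d : nat) : d%:R ^+ d <= d`!%:R * expR d%:R :> R.
Proof.
case: d => [|d]; first by rewrite expr0 fact0 mul1r expR0.
have fact_gt0' : 0 < d.+1`!%:R :> R by rewrite ltr0n fact_gt0.
rewrite mulrC -ler_pdivrMr //; apply: le_trans (expR_ge1Dxn d (ler0n _ _)).
by rewrite lerDr ler01.
Qed.

(** The usual bound [(e * n / d) ^ d] on a binomial coefficient, without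
    division. *)
Lemma bin_expn_le (n d : nat) :
  'C(n, d)%:R * d%:R ^+ d <= n%:R ^+ d * expR d%:R :> R.
Proof.
apply: (@le_trans _ _ ('C(n, d)%:R * (d`!%:R * expR d%:R))).
  by rewrite ler_wpM2l ?ler0n // exprn_le_fact_expR.
rewrite mulrA -natrM bin_ffact ler_wpM2r ?expR_ge0 // -natrX ler_nat.
elim: d => [|d IH]; first by rewrite ffactn0.
by rewrite ffactnSr expnSr leq_mul ?leq_subr.
Qed.

Lemma sum_by_card (n : nat) (h : nat -> R) :
  \sum_(A : {set 'I_n}) h #|A| = \sum_(d < n.+1) 'C(n, d)%:R * h d.
Proof.
have cardA (A : {set 'I_n}) : (#|A| < n.+1)%N.
  by rewrite ltnS -[leqRHS](card_ord n) max_card.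
rewrite (partition_big (fun A : {set 'I_n} => inord #|A| : 'I_n.+1) predT) //=.
apply: eq_bigr => d _.
rewrite (eq_bigl (fun A : {set 'I_n} => A \in [set A : {set 'I_n} | #|A| == d])).
  rewrite (eq_bigr (fun=> h d)) => [|A]; last by rewrite inE => /eqP ->.
  by rewrite sumr_const card_draws card_ord mulr_natl.
by move=> A; rewrite inE -(inj_eq val_inj) /= inordK.
Qed.

Lemma geometric_tail_le (x : R) (m : nat) : 0 <= x -> 2 * x <= 1 ->
  \sum_(d < m) x ^+ d.+1 <= 2 * x.
Proof.
move=> x0 x1; suff: \sum_(d < m) x ^+ d.+1 + 2 * x ^+ m.+1 <= 2 * x.
  by apply: le_trans; rewrite lerDl mulr_ge0 ?exprn_ge0.
elim: m => [|m IH]; first by rewrite big_ord0 add0r expr1.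
apply: le_trans IH; rewrite big_ord_recr /= -addrA lerD2l.
have : 2 * x * x ^+ m.+1 <= x ^+ m.+1 by rewrite ler_piMl ?exprn_ge0.
rewrite [x ^+ m.+2]exprS; lra.
Qed.

Lemma card_moved_eq (n : nat) (A : {set 'I_n}) :
  (#|[set nu : {ffun 'I_n -> 'I_n} | moved nu == A]| <= n ^ #|A|)%N.
Proof.
pose F i : {pred 'I_n} := if i \in A then predT else pred1 i.
apply: (@leq_trans #|family F|).
  apply: subset_leq_card; apply/fintype.subsetP => nu; rewrite inE => /eqP nuA.
  apply/familyP => i; rewrite /F; case: ifPn => //.
  by rewrite -nuA !inE negbK.
rewrite card_family foldrE big_image /=.
rewrite (bigID (mem A)) /= [X in (_ * X)%N]big1 ?muln1 => [|i iA].
  rewrite (eq_bigr (fun=> n)) => [|i iA]; first by rewrite prod_nat_const.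
  by rewrite /F iA card_ord.
by rewrite /F (negbTE iA) card1.
Qed.

End Counting.

Section Errors.
Variables (R : realType) (n : nat).
Implicit Types (A : {set 'I_n}).

Lemma card_edges_from (i1 : bool) A :
  (#|[set e : edge n | (if i1 then (val e).1 else (val e).2) \in A]|
   <= #|A| * n)%N.
Proof.
have -> : (#|A| * n)%N = #|finset.setX A [set: 'I_n]|.
  by rewrite finset.cardsX cardsT card_ord.
pose f (e : edge n) := if i1 then val e else ((val e).2, (val e).1).
have f_inj : injective f.
  rewrite /f; case: (i1) => e e' h; apply: val_inj => //.
  by case: h => h2 h1; rewrite [LHS]surjective_pairing h1 h2 -surjective_pairing.
rewrite -(card_imset _ f_inj); apply: subset_leq_card.
apply/fintype.subsetP => x /imsetP[e]; rewrite inE => eA ->.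
by rewrite [f e]surjective_pairing finset.in_setX finset.in_setT andbT /f; case: (i1) eA.
Qed.

Lemma card_edges_inside A :
  (#|[set e : edge n | ((val e).1 \in A) && ((val e).2 \in A)]|
   <= #|A| * #|A|)%N.
Proof.
rewrite -finset.cardsX -(card_imset _ val_inj); apply: subset_leq_card.
apply/fintype.subsetP => x /imsetP[e]; rewrite inE => eA ->.
by rewrite [val e]surjective_pairing finset.in_setX.
Qed.

Lemma sum_expr_endpoints_le A (t : R) : 0 <= t ->
  \sum_(e : edge n | (0 < endpoints_in A e)%N) t ^+ endpoints_in A e
  <= #|A|%:R ^+ 2 * t ^+ 2 + 2 * (#|A|%:R * n%:R * t).
Proof.
move=> t0.
have t20 : 0 <= t ^+ 2 by rewrite exprn_ge0.
apply: (@le_trans _ _ (\sum_(e : edge n)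
   (((e \in [set e : edge n | ((val e).1 \in A) && ((val e).2 \in A)])%:R * t ^+ 2
   + (e \in [set e : edge n | (val e).1 \in A])%:R * t)
   + (e \in [set e : edge n | (val e).2 \in A])%:R * t))).
  rewrite big_mkcond /=; apply: ler_sum => e _; rewrite !inE /endpoints_in.
  by case: (_ \in A); case: (_ \in A) => /=; lra.
have cardE (S : {set edge n}) (a : R) : \sum_e (e \in S)%:R * a = #|S|%:R * a.
  rewrite -mulr_suml -sum1_card natr_sum [in RHS]big_mkcond; congr (_ * _).
  by apply: eq_bigr => e _; case: (_ \in S).
rewrite !big_split /= !cardE -addrA lerD //.
  by rewrite ler_wpM2r // expr2 -natrM ler_nat card_edges_inside.
rewrite mulrDl !mul1r lerD // ler_wpM2r // -natrM ler_nat.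
  exact: (card_edges_from true).
exact: (card_edges_from false).
Qed.

(** Chernoff's method applied to the union bound itself: a witness has weight
    at least [4 * #|moved nu|], so its term may be multiplied by [t] to the power
    of the excess weight, after which the sum over all sets of edges factorizes. *)
Lemma sum_error_witness_le (nu : 'I_n -> 'I_n) (q t : R) :
  0 <= q -> 1 <= t ->
  \sum_(T : {set edge n} | error_witness nu T) q ^+ (#|T| + #|lift_edge nu @: T|)
  <= t ^- (4 * #|moved nu|) *
     expR (q ^+ 2 * (#|moved nu|%:R ^+ 2 * t ^+ 2
                     + 2 * (#|moved nu|%:R * n%:R * t))).
Proof.
move=> q0 t1; set A := moved nu; have t0 : 0 < t by exact: lt_le_trans t1.
pose P (e : edge n) := (0 < endpoints_in A e)%N.
pose a (e : edge n) := q ^+ 2 * t ^+ endpoints_in A e.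
have a0 e : 0 <= a e by rewrite mulr_ge0 ?exprn_ge0 // ltW.
apply: (@le_trans _ _ (t ^- (4 * #|A|) *
    \sum_(T : {set edge n}) \prod_e (if e \in T then (P e)%:R * a e else 1))).
  rewrite mulr_sumr big_mkcond /=; apply: ler_sum => T _.
  have prod_ge0 : 0 <= \prod_e (if e \in T then (P e)%:R * a e else 1).
    by apply: prodr_ge0 => e _; case: ifP => _ //; rewrite mulr_ge0.
  case: ifPn => [/and4P[Tdis /eqP Tinj /forall_inP TP Tw]|_]; last first.
    by rewrite mulr_ge0 // invr_ge0 exprn_ge0 // ltW.
  rewrite Tinj -big_mkcond /=.
  rewrite (eq_bigr a) => [|e /TP h]; last by rewrite /P h mul1r.
  rewrite big_split /= prodr_const -exprM addnn -mul2n prodrXr.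
  rewrite mulrCA ler_peMr ?exprn_ge0 // mulrC ler_pdivlMr ?exprn_gt0 // mul1r.
  exact: ler_weXn2l.
rewrite ler_wpM2l ?invr_ge0 ?exprn_ge0 ?(ltW t0) //.
rewrite -bigA_distr /=.
apply: (@le_trans _ _ (\prod_e expR ((P e)%:R * a e))).
  apply: ler_prod => e _; rewrite addrC expR_ge1Dx andbT.
  by rewrite addr_ge0 // mulr_ge0.
rewrite -expR_sum ler_expR.
rewrite (eq_bigr (fun e => if P e then a e else 0)); last first.
  by move=> e _; case: (P e); rewrite ?mul1r ?mul0r.
rewrite -big_mkcond /= -mulr_sumr ler_wpM2l ?exprn_ge0 //.
by apply: sum_expr_endpoints_le; exact: ltW.
Qed.

(** The tilt depends on the number [d] of errors: [t = n / sqrt d] is the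
    largest, up to a constant, for which the exponent in
    [sum_error_witness_le] stays of order [d]. *)
Lemma sum_all_errors_le (c : R) : 0 <= c -> (0 < n)%N ->
  2 * (expR (1 + 3 * c ^+ 2) / n%:R) <= 1 ->
  \sum_(nu : {ffun 'I_n -> 'I_n} | moved nu != finset.set0)
    \sum_(T : {set edge n} | error_witness nu T)
      (c / n%:R) ^+ (#|T| + #|lift_edge nu @: T|)
  <= 2 * (expR (1 + 3 * c ^+ 2) / n%:R).
Proof.
move=> c0 n0 K1; set K := expR _ / _ in K1 *.
have n0' : 0 < n%:R :> R by rewrite ltr0n.
pose h (d : nat) : R := ((d%:R ^+ 2 / n%:R ^+ 4) * expR (3 * c ^+ 2)) ^+ d.
have h0 d : 0 <= h d.
  by rewrite exprn_ge0 // !mulr_ge0 ?expR_ge0 ?invr_ge0 ?exprn_ge0 ?ler0n.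
have hP (nu : {ffun 'I_n -> 'I_n}) : moved nu != finset.set0 ->
    \sum_(T : {set edge n} | error_witness nu T)
      (c / n%:R) ^+ (#|T| + #|lift_edge nu @: T|) <= h #|moved nu|.
  move=> nu0; set d := #|moved nu|.
  have d0 : 0 < d%:R :> R by rewrite ltr0n card_gt0.
  have d1 : 1 <= d%:R :> R by rewrite ler1n card_gt0.
  have dn : d%:R <= n%:R :> R by rewrite ler_nat -[leqRHS](card_ord n) max_card.
  (* The tilt is [n / r]. *)
  pose r : R := Num.sqrt d%:R.
  have r2 : r ^+ 2 = d%:R by rewrite sqr_sqrtr ?ltW.
  have r4 : r ^+ 4 = d%:R ^+ 2 by rewrite -r2 -exprM.
  have r0 : 0 < r by rewrite sqrtr_gt0.
  have r1 : 1 <= r by rewrite -[leLHS]sqrtr1 ler_sqrt ?ler01.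
  have rd : r <= d%:R by rewrite -r2 expr2 ler_peMr // ltW.
  have t1 : 1 <= n%:R / r by rewrite ler_pdivlMr // mul1r (le_trans rd).
  apply: le_trans (sum_error_witness_le nu _ t1) _; first by rewrite divr_ge0 // ltW.
  rewrite -/d /h [leRHS]exprMn -[expR (3 * c ^+ 2) ^+ d]expRM_natl ler_pM //.
  - by rewrite invr_ge0 exprn_ge0 // divr_ge0 ?ltW.
  - rewrite exprM -[leLHS]exprVn lerXn2r ?nnegrE //.
    + by rewrite invr_ge0 exprn_ge0 // divr_ge0 // ltW.
    + by rewrite expr_div_n invf_div r4.
  - rewrite ler_expR.
    have -> : (c / n%:R) ^+ 2 * (d%:R ^+ 2 * (n%:R / r) ^+ 2
        + 2 * (d%:R * n%:R * (n%:R / r))) = c ^+ 2 * (d%:R + 2 * r).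
      by rewrite -r2; field; rewrite !gt_eqF.
    have := ler_wpM2l (exprn_ge0 2 c0) rd; lra.
apply: (le_trans (ler_sum _ hP)).
rewrite (partition_big (fun nu : {ffun 'I_n -> 'I_n} => moved nu)
  (fun A => A != finset.set0)) //=.
pose g (d : nat) : R := if d == 0%N then 0 else n%:R ^+ d * h d.
apply: (@le_trans _ _ (\sum_(A : {set 'I_n}) g #|A|)).
  rewrite big_mkcond /=; apply: ler_sum => A _; rewrite /g cards_eq0.
  case: eqVneq => //= A0.
  rewrite (eq_bigl (fun nu => nu \in [set nu : {ffun 'I_n -> 'I_n} | moved nu == A])).
    rewrite (eq_bigr (fun=> h #|A|)) => [|nu]; last by rewrite inE => /eqP ->.
    rewrite sumr_const -[leLHS]mulr_natl ler_wpM2r // -natrX ler_nat.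
    exact: card_moved_eq.
  move=> nu; rewrite inE andbC; case: eqVneq => //= ->.
  by rewrite A0.
rewrite sum_by_card big_ord_recl /= /g eqxx mulr0 add0r.
have K0 : 0 <= K by rewrite divr_ge0 ?expR_ge0 ?ltW.
apply: le_trans (geometric_tail_le n K0 K1).
apply: ler_sum => -[d' dn] _ /=; rewrite /bump /= add1n; set d := d'.+1.
have dn' : d%:R <= n%:R :> R by rewrite ler_nat.
rewrite /h.
(* One factor [d ^ d] turns the binomial coefficient into [(e * n) ^ d]. *)
have -> : 'C(n, d)%:R * (n%:R ^+ d * (d%:R ^+ 2 / n%:R ^+ 4 * expR (3 * c ^+ 2)) ^+ d)
  = ('C(n, d)%:R * d%:R ^+ d) * (d%:R / n%:R ^+ 3 * expR (3 * c ^+ 2)) ^+ d.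
  rewrite -!mulrA; congr (_ * _); rewrite -!exprMn; congr (_ ^+ _).
  by field; rewrite gt_eqF.
apply: (le_trans (ler_wpM2r _ (bin_expn_le R n d))).
  by rewrite exprn_ge0 // !mulr_ge0 ?expR_ge0 ?invr_ge0 ?exprn_ge0 ?ler0n.
rewrite -[d%:R as X in expR X]mulr1 expRM_natl -!exprMn lerXn2r ?nnegrE //.
rewrite /K expRD.
have -> : n%:R * expR 1 * (d%:R / n%:R ^+ 3 * expR (3 * c ^+ 2))
   = (expR 1 * expR (3 * c ^+ 2) / n%:R) * (d%:R / n%:R).
  by field; rewrite gt_eqF.
by rewrite ler_piMr ?ler_pdivrMr ?mul1r.
Qed.

Lemma prob_error_event_le (w : 'I_n -> R) (s c : R) :
  0 <= s <= 1 -> (forall i j, 0 <= cl_p w i j <= 1) ->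
  (forall i j, cl_p w i j <= c / n%:R) -> 0 <= c -> (0 < n)%N ->
  2 * (expR (1 + 3 * c ^+ 2) / n%:R) <= 1 ->
  corr_cl_prob w s (@error_event n) <= 2 * (expR (1 + 3 * c ^+ 2) / n%:R).
Proof.
move=> s01 p01 pc c0 n0 K1; apply: le_trans (sum_all_errors_le c0 n0 K1).
pose f (nu : {ffun 'I_n -> 'I_n}) (T : {set edge n}) (o : outcome n) : R :=
  ((T \subset first_graph o)
       && (lift_edge nu @: T \subset unshuffled_second_graph o))%:R.
apply: (@le_trans _ _ (cl_expectation w s (fun o =>
  \sum_(nu : {ffun 'I_n -> 'I_n} | moved nu != finset.set0)
    \sum_(T : {set edge n} | error_witness nu T) f nu T o))).
  apply: corr_cl_prob_le_cl_expectation => // o.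
    by apply: sumr_ge0 => nu _; apply: sumr_ge0 => T _; rewrite ler0n.
  move=> /existsP[nu /andP[nu0 /existsP[T /andP[Tw TG]]]].
  rewrite (bigD1 nu) //= (bigD1 T) //= {1}/f TG -addrA lerDl.
  rewrite addr_ge0 // sumr_ge0 // => nu' _; rewrite ?ler0n //.
  by apply: sumr_ge0 => T' _; rewrite ler0n.
rewrite cl_expectation_sum; apply: ler_sum => nu _.
rewrite cl_expectation_sum; apply: ler_sum => T /andP[Tdis _].
apply: cl_expectation_edges_subset => // e; exact: pc.
Qed.

End Errors.

(** * Sparse boundaries are unlikely *)

Section SparseCut.
Variables (R : realType) (n : nat) (w : 'I_n -> R) (s : R).
Implicit Types (S : {set 'I_n}).

(** Chernoff's method with the weight [1 / 2] for each boundary edge present in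
    both graphs, which happens with probability [p * s ^+ 2]. *)
Lemma prob_sparse_cut_event_le (m : nat) (b : R) :
  0 <= s <= 1 -> (forall i j, 0 <= cl_p w i j <= 1) ->
  (forall S, #|S| = m -> b <= \sum_(e : edge n | crosses S e) edge_p w e) ->
  corr_cl_prob w s (sparse_cut_event m)
  <= 'C(n, m)%:R * (2 ^+ (12 * m) * expR (- (s ^+ 2 / 2 * b))).
Proof.
move=> s01 p01 hb.
pose phi S (e : edge n) (x y : bool) : R := if [&& crosses S e, x & y] then 2^-1 else 1.
pose f S (o : outcome n) : R := \prod_e phi S e (e \in first_graph o)
                                   (e \in unshuffled_second_graph o).
have phi_ge0 S e x y : 0 <= phi S e x y.
  by rewrite /phi; case: ifP => _ //; rewrite invr_ge0.
have f0 S o : 0 <= f S o by apply: prodr_ge0.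
apply: (@le_trans _ _ (cl_expectation w s (fun o =>
    \sum_(S : {set 'I_n} | #|S| == m) 2 ^+ (12 * m) * f S o))).
  apply: corr_cl_prob_le_cl_expectation => // o.
    by apply: sumr_ge0 => S _; rewrite mulr_ge0 // exprn_ge0.
  move=> /existsP[S /andP[Sm few]]; rewrite (bigD1 S) //=.
  have fS : f S o = 2^-1 ^+
      #|[set e in first_graph o :&: unshuffled_second_graph o | crosses S e]|.
    rewrite /f /phi -big_mkcond /= prodr_const; congr (_ ^+ _); apply: eq_card => e.
    by rewrite !inE andbC.
  apply: (@le_trans _ _ (2 ^+ (12 * m) * f S o)).
    rewrite fS exprVn ler_pdivlMr ?exprn_gt0 // mul1r.
    by rewrite ler_eXn2l ?ltr1n.
  by rewrite lerDl sumr_ge0 // => S' _; rewrite mulr_ge0 // exprn_ge0.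
rewrite cl_expectation_sum.
apply: (@le_trans _ _ (\sum_(S : {set 'I_n} | #|S| == m)
    2 ^+ (12 * m) * expR (- (s ^+ 2 / 2 * b)))).
  apply: ler_sum => S /eqP Sm; rewrite cl_expectationZ ler_wpM2l ?exprn_ge0 //.
  rewrite cl_expectation_prod.
  have meanE e : edge_mean s (edge_p w e) (phi S e) =
      1 - (if crosses S e then s ^+ 2 / 2 * edge_p w e else 0).
    by rewrite /edge_mean /phi; case: (crosses S e) => /=; lra.
  apply: (@le_trans _ _ (\prod_e expR (-
      (if crosses S e then s ^+ 2 / 2 * edge_p w e else 0)))).
    apply: ler_prod => e _; rewrite meanE expR_ge1Dx andbT subr_ge0.
    have /andP[p0 p1] := p01 (val e).1 (val e).2; have /andP[s0 s1] := s01.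
    case: ifP => _ //; apply: mulr_ile1 => //.
    - by rewrite mulr_ge0 ?exprn_ge0 ?invr_ge0.
    - have : s ^+ 2 <= 1 by rewrite exprn_ile1.
      lra.
  rewrite -expR_sum ler_expR sumrN -big_mkcond /= lerN2 -mulr_sumr.
  by rewrite ler_wpM2l ?hb // divr_ge0 // sqr_ge0.
rewrite (eq_bigl (fun S => S \in [set S : {set 'I_n} | #|S| == m])).
  by rewrite sumr_const card_draws card_ord -[leLHS]mulr_natl.
by move=> S; rewrite inE.
Qed.

Lemma cl_p_sym i j : cl_p w i j = cl_p w j i.
Proof. by rewrite /cl_p eq_sym [w i * _]mulrC. Qed.

(** A crossing edge is an ordered pair from [S] to its complement. *)
Lemma sum_cut S : \sum_(e : edge n | crosses S e) edge_p w e =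
  (\sum_(i in S) w i) * (\sum_(j in ~: S) w j) / \sum_l w l.
Proof.
have -> : (\sum_(i in S) w i) * (\sum_(j in ~: S) w j) / \sum_l w l =
   \sum_(x : 'I_n * 'I_n | (x.1 \in S) && (x.2 \notin S)) cl_p w x.1 x.2.
  rewrite -(pair_big (mem S) (fun j => j \notin S) (fun i j => cl_p w i j)) /=.
  rewrite -mulrA mulr_suml; apply: eq_bigr => i iS.
  rewrite mulr_suml mulr_sumr; apply: eq_big => [j|j jS]; first by rewrite inE.
  rewrite /cl_p; case: eqVneq => [ij|_]; last by rewrite mulrA.
  by rewrite inE -ij iS in jS.
pose h (e : edge n) := if (val e).1 \in S then val e else ((val e).2, (val e).1).
pose h' (x : 'I_n * 'I_n) : option (edge n) :=
  insub (if (x.1 < x.2)%N then x else (x.2, x.1)).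
rewrite (reindex_omap h h') /=; last first.
  case=> i j /andP[/= iS jS]; rewrite /h' /=.
  have [lt|] := ltnP i j; first by rewrite insubT /= /h /= iS.
  rewrite leq_eqVlt => /orP[/eqP/val_inj ji|lt]; first by rewrite ji iS in jS.
  by rewrite insubT /= /h /= (negbTE jS).
apply: eq_big => [e|e _].
  have -> : h' (h e) == Some e.
    have lt : ((val e).1 < (val e).2)%N := valP e.
    rewrite /h' /h; case: (_ \in S); first by rewrite lt valK.
    by rewrite ltnNge ltnW //= -surjective_pairing valK.
  rewrite /crosses /h andbT; case: ifPn => h1.
    by rewrite h1 /=; case: (_ \in S).
  by rewrite /= (negbTE h1) andbT; case: (_ \in S).
by rewrite /h /edge_p; case: ifP => _ //=; rewrite cl_p_sym.
Qed.

(** A set of at most two fifths of the total weight leaves a weight of three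
    fifths on the other side of its boundary. *)
Lemma sum_cut_ge (S : {set 'I_n}) (a b : R) :
  (forall i, a <= w i <= b) -> 0 < a -> (0 < n)%N ->
  #|S|%:R * b <= 2 / 5 * (n%:R * a) ->
  3 / 5 * (#|S|%:R * a) <= \sum_(e : edge n | crosses S e) edge_p w e.
Proof.
move=> wab a0 n0 Sb; rewrite sum_cut.
set W := \sum_l w l; set WS := \sum_(i in S) w i; set WC := \sum_(j in _) w j.
have WE : W = WS + WC.
  rewrite /W (bigID (mem S)) /=; congr (_ + _).
  by apply: eq_bigl => i; rewrite inE.
have Wn : n%:R * a <= W.
  rewrite -[n in n%:R]card_ord mulr_natl -sumr_const.
  by apply: ler_sum => i _; case/andP: (wab i).
have W0 : 0 < W by apply: lt_le_trans Wn; rewrite mulr_gt0 ?ltr0n.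
have WSa : #|S|%:R * a <= WS.
  by rewrite mulr_natl -sumr_const; apply: ler_sum => i _; case/andP: (wab i).
have WSb : WS <= #|S|%:R * b.
  by rewrite mulr_natl -sumr_const; apply: ler_sum => i _; case/andP: (wab i).
have WC35 : 3 / 5 <= WC / W by rewrite ler_pdivlMr //; lra.
rewrite mulrC -mulrA ler_pM //; last by rewrite mulr_ge0 ?ler0n // ltW.
Qed.

End SparseCut.

Section Numeric.
Variable R : realType.

(** The fourth power in the exponential series suffices at [154]; the third
    does not. *)
Lemma linear_le_expR (D : R) : 154 <= D -> 15 * D <= expR ((D - 1) / 7).
Proof.
move=> D154; set x := (D - 1) / 7.
have x21 : 21 <= x by rewrite ler_pdivlMr //; lra.
apply: le_trans (expR_ge1Dxn 3 _); last by lra.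
have -> : D = 7 * x + 1 by rewrite /x; field.
have x3 : 21 ^+ 3 * x <= x ^+ 4.
  rewrite [x ^+ 4]exprSr ler_wpM2r; [by []|lra|].
  by rewrite lerXn2r ?nnegrE //; lra.
have -> : 4`!%:R = 24 :> R by [].
lra.
Qed.

(** The smallest integer strictly above the number of vertices that the core
    may miss when the error term is zero. *)
Definition core_loss (delta : R) (n : nat) : nat :=
  (Num.truncn (3 * expR (- delta) * n%:R)).+1.

Lemma core_loss_bounds (delta : R) (n : nat) :
  3 * expR (- delta) * n%:R <= (core_loss delta n)%:R
    <= 3 * expR (- delta) * n%:R + 1.
Proof.
have h0 : 0 <= 3 * expR (- delta) * n%:R by rewrite !mulr_ge0 ?expR_ge0.
have /andP[h1 h2] := truncn_itv h0.
by rewrite /core_loss ltW //= -natr1 lerD2r.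
Qed.

Lemma core_loss_small (delta D : R) (n : nat) :
  154 <= D -> D <= 7 * delta + 1 -> 5 * D <= n%:R ->
  (core_loss delta n)%:R * D <= 2 / 5 * n%:R.
Proof.
move=> D154 Dd Dn; have /andP[_ h] := core_loss_bounds delta n.
have e15 : 15 * D * expR (- delta) <= 1.
  rewrite expRN ler_pdivrMr ?expR_gt0 // mul1r.
  apply: le_trans (linear_le_expR D154) _; rewrite ler_expR; lra.
have D0 : 0 <= D by lra.
have n0 : 0 <= n%:R :> R by rewrite ler0n.
apply: le_trans (ler_wpM2r D0 h) _.
have := ler_wpM2r n0 e15; lra.
Qed.

(** A set of [m >= expR (- delta) * n] vertices can be chosen in at most
    [expR (m * (delta + 1))] ways.  The exponent
    [m * (delta + 1 + 12 - 3 / 10 * D)] is at most [- m] because [delta] is at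
    most [D / 7] and [D] is at least 154. *)
Lemma entropy_beaten (delta D x : R) (n : nat) :
  154 <= D -> 7 * delta <= D -> (0 < n)%N ->
  3 / 10 * ((core_loss delta n)%:R * D) <= x ->
  'C(n, core_loss delta n)%:R * (2 ^+ (12 * core_loss delta n) * expR (- x))
  <= expR delta / n%:R.
Proof.
move=> D154 dD n0; set m := core_loss delta n => mx.
have n0' : 0 < n%:R :> R by rewrite ltr0n.
have m0 : 0 < m%:R :> R by rewrite ltr0n.
have /andP[mlow _] := core_loss_bounds delta n; rewrite -/m in mlow mx.
have nm : expR (- delta) * n%:R <= m%:R.
  apply: le_trans mlow; rewrite -mulrA ler_peMl ?mulr_ge0 ?expR_ge0 ?ler0n //.
  by rewrite ler1n.
have nm' : n%:R <= expR delta * m%:R.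
  by rewrite -ler_pdivrMl ?expR_gt0 // -expRN.
have e1 : expR 1 * 1 >= 2 :> R by rewrite mulr1; have := expR_ge1Dx (1 : R); lra.
have two : 2 ^+ (12 * m) <= expR (12 * m%:R) :> R.
  rewrite -[12 * m%:R]mulr1 -natrM expRM_natl lerXn2r ?nnegrE ?expR_ge0 //.
  by rewrite mulr1 in e1.
have bin : 'C(n, m)%:R <= expR (m%:R * (delta + 1)) :> R.
  rewrite -(ler_pM2r (exprn_gt0 m m0)); apply: le_trans (bin_expn_le R n m) _.
  have -> : expR (m%:R * (delta + 1)) * m%:R ^+ m =
      (expR delta * m%:R) ^+ m * expR m%:R.
    by rewrite exprMn mulrDr mulr1 expRD expRM_natl; ring.
  rewrite ler_wpM2r ?expR_ge0 // lerXn2r ?nnegrE ?mulr_ge0 ?expR_ge0 ?ler0n //.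
apply: (@le_trans _ _ (expR (- m%:R))).
  apply: (@le_trans _ _ (expR (m%:R * (delta + 1)) * (expR (12 * m%:R) * expR (- x)))).
    by rewrite ler_pM ?mulr_ge0 ?exprn_ge0 ?expR_ge0 ?ler_wpM2r ?expR_ge0.
  rewrite -!expRD ler_expR.
  have := ler_wpM2l (ltW m0) dD; have := ler_wpM2l (ltW m0) D154; lra.
rewrite expRN ler_pdivlMr // ler_pdivrMl ?expR_gt0 //.
apply: le_trans nm' _; rewrite mulrC ler_wpM2r ?expR_ge0 //.
have := expR_ge1Dx (m%:R : R); lra.
Qed.

End Numeric.

(** * The estimator on [n] vertices *)

Section Fixed.
Variables (R : realType) (n : nat) (w : 'I_n -> R) (s : R).

Lemma sum_cl_p (i : 'I_n) : \sum_l w l != 0 ->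
  \sum_j cl_p w i j = w i * (1 - w i / \sum_l w l).
Proof.
move=> W0; rewrite (bigD1 i) //= {1}/cl_p eqxx add0r.
rewrite (eq_bigr (fun j => w i / (\sum_l w l) * w j)) => [|j ji]; last first.
  by rewrite /cl_p eq_sym (negbTE ji); ring.
rewrite -mulr_sumr.
have -> : \sum_(j | j != i) w j = \sum_l w l - w i.
  by rewrite [X in _ = X - _](bigD1 i) //=; ring.
by field.
Qed.

Lemma cl_p_itv : (forall i, 0 <= w i) -> fmax w <= Num.sqrt (\sum_l w l) ->
  forall i j, 0 <= cl_p w i j <= 1.
Proof.
move=> w0 wW i j; set W := \sum_l w l in wW *.
have n0 : (0 < n)%N by exact: leq_trans (ltn_ord i).
have [_ w_ub] := fmaxP w n0.
have W0 : 0 <= W by exact: sumr_ge0.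
have wW' l : w l <= Num.sqrt W by exact: le_trans (w_ub l) wW.
rewrite /cl_p -/W; case: ifP => _; first by rewrite lexx ler01.
rewrite divr_ge0 ?mulr_ge0 //=.
move: W0; rewrite le_eqVlt => /predU1P[<-|W0]; first by rewrite invr0 mulr0 ler01.
rewrite ler_pdivrMr // mul1r -[leRHS](sqr_sqrtr (ltW W0)) expr2.
exact: ler_pM.
Qed.

(** A seventh of the minimal mean degree of the intersection graph. *)
Definition min_rate := fmin (fun i => (\sum_(j < n) cl_p w i j * s ^+ 2) / 7).

(** With [D = w_min * s ^+ 2], the ratio [w_max / w_min] is at most its square,
    hence at most [D], and [7 * min_rate] lies between [D - 1] and [D]. *)
Lemma prob_good_ge (C eps : R) (est : outcome n -> matching n) :
  (forall i, 0 <= w i) -> fmax w <= Num.sqrt (\sum_i w i) -> 0 <= s <= 1 ->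
  fmax w <= C -> 0 < eps ->
  Num.max ((fmax w / fmin w) ^+ 2) 154 + eps <= fmin w * s ^+ 2 ->
  is_core_estimator 13 est -> (0 < n)%N ->
  5 * C <= n%:R -> C ^+ 2 <= n%:R ->
  2 * expR (1 + 3 * (C ^+ 2) ^+ 2) <= n%:R ->
  1 - (2 * expR (1 + 3 * (C ^+ 2) ^+ 2) + expR (C / 7)) / n%:R <=
  corr_cl_prob w s (fun o =>
    ((1 - 3 * expR (- min_rate)) * n%:R <= #|(est o).1|%:R)
    && (map_graph (est o).2 (est o).1 == map_graph (latent_perm o) (est o).1)).
Proof.
move=> w0 wW s01 bC eps0 hD est_core n0 n5C nC2 nK.
have n0' : 0 < n%:R :> R by rewrite ltr0n.
have [[imax bE] b_ub] := fmaxP w n0; have [[imin aE] a_lb] := fminP w n0.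
set a := fmin w in hD aE a_lb *; set b := fmax w in wW bC hD bE b_ub *.
set W := \sum_i w i in wW.
have /andP[s0 s1] := s01.
have s2_ge0 : 0 <= s ^+ 2 by exact: sqr_ge0.
have s2_le1 : s ^+ 2 <= 1 by exact: exprn_ile1.
pose D := a * s ^+ 2.
have [rhoD D154] : (b / a) ^+ 2 <= D /\ 154 <= D.
  by move: hD; rewrite -/D -lerBrDr ge_max => /andP[]; split; lra.
have a_ge0 : 0 <= a by rewrite aE.
have Da : D <= a by rewrite ler_piMr.
have a154 : 154 <= a by apply: le_trans Da.
have a0 : 0 < a by lra.
have ab : a <= b by rewrite aE.
have DC : D <= C by apply: le_trans Da (le_trans ab bC).
have C0 : 0 < C by lra.
have rho1 : 1 <= b / a by rewrite ler_pdivlMr // mul1r.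
have rho_le : b / a <= D.
  by apply: le_trans rhoD; rewrite expr2 ler_peMr // (le_trans _ rho1).
have Wn : n%:R <= W.
  rewrite -[n in n%:R]card_ord -sumr_const; apply: ler_sum => i _.
  by have := a_lb i; lra.
have W0 : 0 < W by lra.
have p01 := cl_p_itv w0 wW.
have pC i j : cl_p w i j <= C ^+ 2 / n%:R.
  rewrite /cl_p; case: ifP => _; first by rewrite divr_ge0 ?sqr_ge0 // ltW.
  have wC l : w l <= C by apply: le_trans (b_ub l) bC.
  rewrite expr2 ler_pM ?mulr_ge0 ?invr_ge0 ?(ltW W0) // ?ler_pM //.
  by rewrite lef_pV2 ?posrE.
have W_neq0 : W != 0 by rewrite gt_eqF.
have degE i : (\sum_j cl_p w i j * s ^+ 2) / 7 = w i * s ^+ 2 * (1 - w i / W) / 7.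
  by rewrite -mulr_suml sum_cl_p //; congr (_ / 7); rewrite -/W; ring.
have [[i0 dE] d_lb] := fminP (fun i => (\sum_j cl_p w i j * s ^+ 2) / 7) n0.
rewrite -/min_rate in dE d_lb.
have dD : 7 * min_rate <= D.
  have := d_lb imin; rewrite degE -aE -/D.
  have : D * (1 - a / W) <= D.
    rewrite ler_piMr ?lerBlDr ?lerDl ?divr_ge0 //; first lra.
    exact: ltW.
  lra.
have Dd : D <= 7 * min_rate + 1.
  rewrite dE degE.
  have wi : w i0 / W <= C / n%:R.
    rewrite ler_pM ?w0 ?invr_ge0 ?(ltW W0) //; first exact: le_trans (b_ub i0) bC.
    by rewrite lef_pV2 ?posrE.
  have CCn : C / n%:R * C <= 1 by rewrite mulrAC ler_pdivrMr // mul1r -expr2.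
  have Cn1 : C / n%:R <= 1 by rewrite ler_pdivrMr // mul1r; lra.
  have Cn0 : 0 <= C / n%:R by rewrite divr_ge0 // ltW.
  have Dwi : D <= w i0 * s ^+ 2 by rewrite ler_wpM2r.
  have h1 : D * (1 - C / n%:R) <= w i0 * s ^+ 2 * (1 - w i0 / W).
    by rewrite ler_pM // ?subr_ge0 ?lerD2l ?lerN2 //; lra.
  have h2 : D * (C / n%:R) <= 1.
    by apply: le_trans CCn; rewrite mulrC ler_wpM2l.
  lra.
set m := core_loss min_rate n.
have K1 : 2 * (expR (1 + 3 * (C ^+ 2) ^+ 2) / n%:R) <= 1.
  by rewrite mulrA ler_pdivrMr // mul1r.
have error_le := prob_error_event_le s01 p01 pC (sqr_ge0 C) n0 K1.
have mD : m%:R * D <= 2 / 5 * n%:R.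
  by apply: core_loss_small => //; apply: le_trans n5C; rewrite ler_pM2l.
have mb : m%:R * b <= 2 / 5 * (n%:R * a).
  have -> : b = b / a * a by rewrite divfK // gt_eqF.
  rewrite !mulrA ler_wpM2r //; apply: le_trans mD.
  by rewrite -mulrA ler_wpM2l.
have cut_ge (S : {set 'I_n}) : #|S| = m ->
    3 / 5 * (m%:R * a) <= \sum_(e : edge n | crosses S e) edge_p w e.
  move=> Sm; rewrite -Sm; apply: (sum_cut_ge (b := b)) => //; last by rewrite Sm.
  by move=> i; rewrite a_lb b_ub.
have sparse_le := prob_sparse_cut_event_le s01 p01 cut_ge.
have sparse_le' : corr_cl_prob w s (@sparse_cut_event n m) <= expR (C / 7) / n%:R.
  apply: le_trans sparse_le _; apply: le_trans (entropy_beaten D154 dD n0 _) _.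
    by rewrite /D le_eqVlt; apply/orP; left; apply/eqP; rewrite -/m; field.
  rewrite ler_wpM2r ?invr_ge0 ?(ltW n0') // ler_expR; lra.
apply: le_trans (corr_cl_prob_ge (B1 := @error_event n)
  (B2 := @sparse_cut_event n m) s01 p01 _).
  by rewrite -addrA -opprD lerD2l lerN2 mulrDl lerD // -mulrA.
move=> o noerr nosparse.
have [nM ->] := core_estimate_good (est_core o) noerr nosparse.
rewrite eqxx andbT.
have /andP[_ m_le] := core_loss_bounds min_rate n; rewrite -/m in m_le.
have : n.+1%:R <= (#|(est o).1| + m)%:R :> R by rewrite ler_nat.
rewrite natrD -natr1 => nM'; rewrite mulrBl mul1r lerBlDr.
by rewrite -(lerD2r 1) -addrA; apply: le_trans nM' _; rewrite lerD2l.
Qed.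

End Fixed.

(** * The limit *)

Local Open Scope classical_set_scope.

Theorem corollary5 (R : realType)
  (w : forall n : nat, 'I_n -> R) (s : nat -> R)
  (w_ge0 : forall n (i : 'I_n), 0 <= w n i)
  (w_max : forall n : nat, fmax (w n) <= Num.sqrt (\sum_(i < n) w n i))
  (s01 : forall n : nat, 0 <= s n <= 1)
  (w_bounded : exists C : R, \forall n \near \oo, fmax (w n) <= C)
  (eps : R) (eps_gt0 : 0 < eps)
  (w_min : \forall n \near \oo,
     Num.max ((fmax (w n) / fmin (w n)) ^+ 2) 154 + eps
       <= fmin (w n) * s n ^+ 2)
  (est : forall n : nat, outcome n -> matching n)
  (est_core : forall n : nat, is_core_estimator 13 (est n)) :
  exists2 a : nat -> R,
    (fun n => a n / n%:R) @ \oo --> (0 : R) &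
    (fun n => corr_cl_prob (w n) (s n) (fun o =>
       ((1 - 3 * expR (- fmin (fun i => (\sum_(j < n) cl_p (w n) i j * s n ^+ 2)
                                          / 7))) * n%:R - a n
          <= #|(est n o).1|%:R)
       && (map_graph (est n o).2 (est n o).1
             == map_graph (latent_perm o) (est n o).1)))
      @ \oo --> (1 : R).
Proof.
have [C wC] := w_bounded.
exists (fun=> 0); first by under eq_fun do rewrite mul0r; exact: cvg_cst.
pose K := 2 * expR (1 + 3 * (C ^+ 2) ^+ 2) + expR (C / 7).
have K0 : 0 <= K by rewrite addr_ge0 ?mulr_ge0 ?expR_ge0.
apply: (@squeeze_cvgr _ _ _ _ (fun n => 1 - 2 * K * harmonic n) (fun=> 1)); last 2 first.
- rewrite -[X in _ --> X]subr0 -[X in _ - X](mulr0 (2 * K)).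
  apply: cvgB; first exact: cvg_cst.
  by apply: cvgM; [exact: cvg_cst|exact: cvg_harmonic].
- exact: cvg_cst.
near=> n.
have n0 : (0 < n)%N by near: n; exact: nbhs_infty_gt.
have wCn : fmax (w n) <= C by near: n.
have wn : Num.max ((fmax (w n) / fmin (w n)) ^+ 2) 154 + eps
       <= fmin (w n) * s n ^+ 2 by near: n.
have h1 : 5 * C <= n%:R by near: n; exact: nbhs_infty_ger.
have h2 : C ^+ 2 <= n%:R by near: n; exact: nbhs_infty_ger.
have h3 : 2 * expR (1 + 3 * (C ^+ 2) ^+ 2) <= n%:R.
  by near: n; exact: nbhs_infty_ger.
have := prob_good_ge (w_ge0 n) (w_max n) (s01 n) wCn eps_gt0 wn (est_core n) n0 h1 h2 h3.
rewrite -/K => good.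
rewrite corr_cl_prob_le1 ?andbT //; last exact: cl_p_itv.
under [X in _ <= X]eq_bigl do rewrite subr0.
apply: le_trans good; rewrite lerD2l lerN2 [2 * K]mulrC -mulrA ler_wpM2l //.
have n0' : 0 < n%:R :> R by rewrite ltr0n.
rewrite /harmonic ler_pdivlMr ?ltr0n // ler_pdivrMl //.
by rewrite mulrC -natrM ler_nat mul2n -addnn -addn1 leq_add2l.
Unshelve. all: by end_near.
Qed.
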